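(* For each positive integer $n$, $c(n)=1$ if $$n\in\bigcup_{m\ge7}[t_{m-1}+2t_{m-4}..\tfrac{3t_{m-1}-t_{m-3}-3}{2}],$$ and $c(n)=0$ otherwise.
   Context: The Tribonacci substitution $\sigma$ on the alphabet $\{a,b,c\}$ is $\sigma(a)=ab$, $\sigma(b)=ac$, $\sigma(c)=a$. The Tribonacci sequence $\mathbb{T}$ is the infinite word that is the fixed point of $\sigma$ beginning with $a$; $\mathbb{T}[1,n]$ is its prefix of length $n$ ($\mathbb{T}[1,0]$ is empty). Put $T_{-2}=\epsilon$ (empty word), $T_{-1}=c$, $T_m=\sigma^m(a)$ for $m\ge0$, $t_m=|T_m|$ for $m\ge-2$, and $t_{-3}=0$; thus $t_{-3}=t_{-2}=0$, $t_{-1}=t_0=1$, $t_1=2$, $t_2=4$, $t_3=7$, $t_4=13$, and $t_m=t_{m-1}+t_{m-2}+t_{m-3}$ for $m\ge1$. $[x..y]$ denotes the set of integers $\{x,x+1,\ldots,y\}$. Write $u\prec v$ if $u$ is a factor (contiguous subword) of $v$. Let $C(n)=\#\{\omega\mid\omega\text{ non-empty word},\ \omega\omega\omega\prec\mathbb{T}[1,n]\}$ for $n\ge0$ (number of distinct cubes in $\mathbb{T}[1,n]$) and $c(n)=C(n)-C(n-1)$ for $n\ge1$. *)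

(* Defs.v *)
From HB Require Import structures.
From mathcomp Require Import all_boot all_order all_algebra zify.

Set Implicit Arguments.
Unset Strict Implicit.
Unset Printing Implicit Defensive.

Inductive letter : Type := La | Lb | Lc.

Definition letter_to_ord (x : letter) : 'I_3 :=
  inord (match x with La => 0 | Lb => 1 | Lc => 2 end).
Definition letter_of_ord (i : 'I_3) : letter := nth La [:: La; Lb; Lc] i.
Lemma letter_to_ordK : cancel letter_to_ord letter_of_ord.
Proof. by case; rewrite /letter_of_ord /letter_to_ord inordK. Qed.
HB.instance Definition _ := Finite.copy letter (can_type letter_to_ordK).

Definition sigma1 (x : letter) : seq letter :=
  match x with
  | La => [:: La; Lb]
  | Lb => [:: La; Lc]
  | Lc => [:: La]
  end.

Definition sigma (w : seq letter) : seq letter := flatten (map sigma1 w).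

(* Infinite words are indexed from 0: the letter x_i of x = x_1 x_2 ... is
   [x i.-1], so that x[1,n] is [mkseq x n]. *)

(* The image of an infinite word.  As sigma1 never yields the empty word,
   sigma (x[1,n+1]) has at least n+1 letters and the default is never used. *)
Definition sigma_omega (x : nat -> letter) : nat -> letter :=
  fun n => nth La (sigma (mkseq x n.+1)) n.

Definition tribonacci_word (x : nat -> letter) : Prop :=
  x 0 = La /\ sigma_omega x =1 x.

Definition t (m : nat) : nat := size (iter m sigma [:: La]).

(* The number of distinct nonempty w such that www is a factor of x[1,n];
   the bound |w| <= n only serves to make the type of words finite. *)
Definition C (x : nat -> letter) (n : nat) : nat :=
  #|[set w : n.-bseq letter |
      (w != [::] :> seq letter) && infix (w ++ w ++ w) (mkseq x n)]|.

Definition c (x : nat -> letter) (n : nat) : int :=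
  ((C x n)%:Z - (C x n.-1)%:Z)%R.

(* For m >= 7 neither the subtractions nor the division truncate; see
   [cube_position_upper]. *)
Definition cube_position (n : nat) : Prop :=
  exists2 m, 7 <= m &
    t (m - 1) + 2 * t (m - 4) <= n
      <= (3 * t (m - 1) - t (m - 3) - 3) %/ 2.

Lemma sigma_cat u v : sigma (u ++ v) = sigma u ++ sigma v.
Proof. by rewrite /sigma map_cat flatten_cat. Qed.

Lemma iter_sigma_rec m :
  iter m.+3 sigma [:: La] =
  iter m.+2 sigma [:: La] ++ iter m.+1 sigma [:: La] ++ iter m sigma [:: La].
Proof.
by elim: m => [//|m IH]; rewrite [LHS]iterS [in LHS]IH !sigma_cat.
Qed.

Lemma t_rec m : t m.+3 = t m.+2 + t m.+1 + t m.
Proof. by rewrite /t iter_sigma_rec !size_cat addnA. Qed.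

Lemma cube_position_upper m : 7 <= m ->
  2 * ((3 * t (m - 1) - t (m - 3) - 3) %/ 2) + t (m - 3) + 3 = 3 * t (m - 1).
Proof.
move=> /subnKC <-; move: (m - 7) => k.
have -> : 7 + k - 1 = k.+4.+2 by lia.
have -> : 7 + k - 3 = k.+4 by lia.
have : [/\ (t k.+2 + t k) %% 2 = 1, (t k.+3 + t k.+1) %% 2 = 1
    & t k.+1 <= t k.+2].
  elim: k => [//|k [H1 H2 H3]].
  by move: (t_rec k) (t_rec k.+1) => E1 E2; split; lia.
case=> H1 H2 H3; move: (t_rec k) (t_rec k.+1) (t_rec k.+2) (t_rec k.+3).
lia.
Qed.

Lemma size_sigma w : size w <= size (sigma w).
Proof. by elim: w => [//|[] w IH] /=; rewrite !ltnS // ltnW. Qed.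

Lemma size_iter_sigma m : m < size (iter m sigma [:: La]).
Proof.
elim: m => [//|m IH].
have [v Hv] : exists v, iter m sigma [:: La] = La :: v.
  elim: m {IH} => [|k [v Hv]]; first by exists [::].
  by rewrite iterS Hv; exists (Lb :: sigma v).
by move: IH; rewrite iterS Hv /= !ltnS => /leq_trans; apply; apply: size_sigma.
Qed.

Lemma prefix_iter_sigma m k :
  prefix (iter m sigma [:: La]) (iter (m + k) sigma [:: La]).
Proof.
elim: k => [|k IH]; first by rewrite addn0 prefix_refl.
apply: prefix_trans IH _; rewrite addnS.
elim: (m + k) => [|j /prefixP [u Hu]]; apply/prefixP; first by exists [:: Lb].
exists (sigma u).
by rewrite [RHS]/= -sigma_cat -Hu.
Qed.

Lemma nth_prefix (u v : seq letter) i :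
  prefix u v -> i < size u -> nth La v i = nth La u i.
Proof. by move=> /prefixP [w ->] ltiu; rewrite nth_cat ltiu. Qed.

Lemma nth_iter_sigma m k i :
    i < size (iter m sigma [:: La]) -> i < size (iter k sigma [:: La]) ->
  nth La (iter m sigma [:: La]) i = nth La (iter k sigma [:: La]) i.
Proof.
wlog lemk : m k / m <= k.
  by move=> W Hm Hk; case/orP: (leq_total m k) => ?; [|symmetry]; apply: W.
move=> Hm _; symmetry; apply: nth_prefix Hm.
by rewrite -(subnKC lemk) prefix_iter_sigma.
Qed.

Lemma tribonacci_word_exists : exists x, tribonacci_word x.
Proof.
exists (fun n => nth La (iter n sigma [:: La]) n); split=> // n.
rewrite /sigma_omega; set u := mkseq _ _.
have Eu : u = take n.+1 (iter n.+1 sigma [:: La]).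
  apply: (@eq_from_nth _ La).
    by rewrite size_mkseq size_takel // ltnW // size_iter_sigma.
  move=> i; rewrite size_mkseq => lti; rewrite nth_mkseq // nth_take //.
  apply: nth_iter_sigma; first exact: size_iter_sigma.
  by apply: (leq_trans lti); rewrite ltnW // size_iter_sigma.
have ltnu : n < size (sigma u).
  by apply: leq_trans (size_sigma u); rewrite size_mkseq.
have pu : prefix (sigma u) (iter n.+2 sigma [:: La]).
  have -> : iter n.+2 sigma [:: La] = sigma (iter n.+1 sigma [:: La]) by [].
  rewrite -(cat_take_drop n.+1 (iter n.+1 sigma [:: La])) -Eu sigma_cat.
  exact: prefix_prefix.
rewrite -(nth_prefix pu ltnu); apply: nth_iter_sigma; last exact: size_iter_sigma.
by apply: leq_trans (size_iter_sigma n.+2); rewrite ltnS ltnW.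
Qed.

Lemma tribonacci_word_unique x y :
  tribonacci_word x -> tribonacci_word y -> x =1 y.
Proof.
move=> [x0 xfix] [y0 yfix].
suff eqp n : mkseq x n.+1 = mkseq y n.+1.
  move=> n; move/(congr1 (fun s => nth La s n)): (eqp n).
  by rewrite !nth_mkseq.
elim: n => [|n IH]; first by rewrite /mkseq /= x0 y0.
have step z : z 0 = La -> sigma_omega z =1 z ->
    z n.+1 = nth La (sigma (mkseq z n.+1)) n.+1.
  move=> z0 zfix; rewrite -[LHS]zfix /sigma_omega.
  rewrite [X in sigma X]mkseqS -cats1 sigma_cat nth_cat.
  suff -> : n.+1 < size (sigma (mkseq z n.+1)) by [].
  have -> : mkseq z n.+1 = La :: mkseq (z \o succn) n.
    by rewrite /mkseq /= z0 -[1]addn0 iotaDl -map_comp.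
  by rewrite /= !ltnS; apply: leq_trans (size_sigma _); rewrite size_mkseq.
by rewrite [LHS]mkseqS [RHS]mkseqS (step x) // (step y) // IH.
Qed.

Lemma C_spec x n (S : seq (seq letter)) :
    uniq S ->
    (forall w, w \in S = (w != [::]) && infix (w ++ w ++ w) (mkseq x n)) ->
  C x n = size S.
Proof.
move=> uS SP; rewrite /C cardE.
rewrite -(size_map (fun w : n.-bseq letter => w : seq letter)).
apply/perm_size/uniq_perm => //.
  by rewrite map_inj_uniq ?enum_uniq //; apply: val_inj.
move=> w; rewrite SP; apply/mapP/idP => [[v]|Hw].
  by rewrite mem_enum inE => Hv ->.
have lewn : size w <= n.
  case/andP: Hw => _ /size_infix; rewrite !size_cat size_mkseq.
  exact/leq_trans/leq_addr.
by exists (Bseq lewn); rewrite // mem_enum inE.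
Qed.

(* Main.v *)
(** Write pos I for the length of the image of x[0, I), so that the block sigma (x I)
    starts at position pos I of x.  Block starts are exactly the occurrences of La, hence
    a segment of x with period p and not too short is, up to one letter on the right,
    contained in the image of a segment with a smaller period q.  A segment of period p
    and length at least 3 p - 1 desubstitutes to one of period q and length at least
    3 q - 1 (a larger deficit would have an image of at least three letters, as Lc Lc does
    not occur), so the descent ends at period 1, that is at a factor La La.  Thus every
    cube has a root of length t m and lies in a run obtained from an occurrence of La La
    at some I by m applications of u |-> sigma u La; this run starts at the m-th iterate
    of pos at I.
    As La La first occurs at I = 6, every such cube occurs first in the run attached to
    I = 6.  That run is shorter than 4 t m, which forces its cubes to be distinct: two
    equal ones at distance d would create a run of period d < t m and length
    at least 3 t m + d. *)
Require Import Defs.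
From mathcomp Require Import all_boot all_order all_algebra.
From mathcomp Require Import zify.

Set Implicit Arguments.
Unset Strict Implicit.
Unset Printing Implicit Defensive.

(** * Length of the runs and growth of [t] *)

Fixpoint run m := if m is m'.+1 then rcons (sigma (run m')) La else [:: La; La].

(* run m is sigma^m (La La) followed by T_(m-1) ... T_1 T_0. *)
Lemma size_run m : size (run m) = 2 * t m + \sum_(k < m) t k.
Proof.
pose tail k := iteri k (fun j u => iter j sigma [:: La] ++ u) [::].
have tailS k : tail k.+1 = rcons (sigma (tail k)) La.
  elim: k => // k IHk; have tailE j : tail j.+1 = iter j sigma [:: La] ++ tail j by [].
  by rewrite tailE [in LHS]IHk tailE sigma_cat rcons_cat.
have -> : run m = iter m sigma [:: La] ++ iter m sigma [:: La] ++ tail m.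
  elim: m => // m IHm.
  by rewrite [LHS]/= IHm !sigma_cat !rcons_cat -tailS.
have -> : \sum_(k < m) t k = size (tail m).
  by elim: m => [|m IHm]; rewrite ?big_ord0 // big_ord_recr /= IHm size_cat addnC.
by rewrite !size_cat mul2n -addnn addnA.
Qed.

(** This removes the sum from [size_run] and leaves linear arithmetic in values of [t]. *)
Lemma sum_t m : 2 * (\sum_(k < m) t k) + t m + 3 = t m.+2.
Proof.
elim: m => [|m IH]; first by rewrite big_ord0.
by rewrite big_ord_recr mulnDr t_rec -IH /=; lia.
Qed.

Lemma leq_tS m : t m <= t m.+1.
Proof. exact: size_sigma. Qed.

(** By [sum_t], twice the length is [3 * t m + t m.+2 - 3], and [sigma] at most doubles lengths. *)
Lemma size_run_lt m : size (run m) < 4 * t m.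
Proof.
have dbl k : t k.+1 <= 2 * t k.
  by rewrite /t iterS; elim: (iter k _ _) => //= -[] u; rewrite /sigma /=; lia.
rewrite size_run; have := sum_t m.
by have := dbl m; have := dbl m.+1; lia.
Qed.

Lemma iter_sigma_cat m u v :
  iter m sigma (u ++ v) = iter m sigma u ++ iter m sigma v.
Proof. by elim: m => //= m ->; rewrite sigma_cat. Qed.

Lemma leq_t : {homo t : m n / m <= n}.
Proof. by apply: homo_leq leq_tS; [exact: leqnn|exact: leq_trans]. Qed.

Lemma t_inj m n : 2 < m -> 2 < n -> t m = t n -> m = n.
Proof.
wlog ltmn : m n / m < n.
  by move=> W m3 n3; case: (ltngtP m n) => // lt E; [|symmetry]; apply: W.
case: m ltmn => [//|[//|m]] ltmn _ _ E; have := leq_t ltmn.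
have := t_rec m; have : 0 < t m by exact: leq_ltn_trans (size_iter_sigma m).
by have := leq_tS m; lia.
Qed.

(** * Blocks and short factors of the Tribonacci word *)

Section Word.

Variable x : nat -> letter.
Hypothesis x_trib : tribonacci_word x.

Definition pos I := size (sigma (mkseq x I)).

Lemma posS I : pos I.+1 = pos I + size (sigma1 (x I)).
Proof. by rewrite /pos mkseqS -cats1 sigma_cat size_cat /sigma /= cats0. Qed.

Lemma leq_pos I J : (pos I <= pos J) = (I <= J).
Proof.
apply: (leq_mono (f := pos)); apply: (homo_ltn (f := pos) ltn_trans) => {}I.
by rewrite posS -[ltnLHS]addn0 ltn_add2l; case: (x I).
Qed.

Lemma ltn_pos I J : (pos I < pos J) = (I < J).
Proof. by rewrite !ltnNge leq_pos. Qed.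

Lemma prefix_mkseq m n : m <= n -> prefix (mkseq x m) (mkseq x n).
Proof.
by move=> /subnKC <-; rewrite /mkseq iotaD map_cat prefix_prefix.
Qed.

Lemma prefix_sigma u v : prefix u v -> prefix (sigma u) (sigma v).
Proof. by case/prefixP=> w ->; rewrite sigma_cat prefix_prefix. Qed.

Lemma mkseq_pos I : mkseq x (pos I) = sigma (mkseq x I).
Proof.
apply: (@eq_from_nth _ La); first by rewrite size_mkseq.
move=> k; rewrite size_mkseq => ltk; rewrite nth_mkseq //.
case: x_trib => _ /(_ k) <-; rewrite /sigma_omega.
have ltk' : k < size (sigma (mkseq x k.+1)).
  by apply: leq_trans (size_sigma _); rewrite size_mkseq.
case/orP: (leq_total I k.+1) => leI.
  by apply: nth_prefix ltk; apply/prefix_sigma/prefix_mkseq.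
by symmetry; apply: nth_prefix ltk'; apply/prefix_sigma/prefix_mkseq.
Qed.

Lemma x_block I k : k < size (sigma1 (x I)) ->
  x (pos I + k) = nth La (sigma1 (x I)) k.
Proof.
move=> ltk.
have := congr1 (fun s => nth La s (pos I + k)) (mkseq_pos I.+1).
rewrite nth_mkseq ?posS ?ltn_add2l // => ->.
rewrite mkseqS -cats1 sigma_cat nth_cat /pos ltnNge leq_addr /= addKn.
by rewrite /sigma /= cats0.
Qed.

Lemma x_pos I : x (pos I) = La.
Proof. by rewrite -[pos I]addn0 x_block; case: (x I). Qed.

(* The letter of x that follows the start of the block sigma1 l. *)
Definition next (l : letter) : letter :=
  match l with La => Lb | Lb => Lc | Lc => La end.

(** The letter after a block start thus determines the block, which makes desubstitution
    possible. *)
Lemma next_inj : injective next.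
Proof. by case; case. Qed.

Lemma x_posS I : x (pos I).+1 = next (x I).
Proof.
case E: (x I); last first.
  by have := posS I; rewrite E addn1 => <-; rewrite x_pos.
all: by rewrite -addn1 x_block E.
Qed.

Lemma pos_cover k : exists I, k = pos I \/ k = (pos I).+1 /\ x I <> Lc.
Proof.
elim: k => [|k [I [->|[-> xI]]]]; first by exists 0; left.
  case E: (x I); try by exists I; right; rewrite E.
  by exists I.+1; left; rewrite posS E addn1.
by exists I.+1; left; rewrite posS; case: (x I) xI => //= _; rewrite addn2.
Qed.

Lemma pos_of_La k : x k = La -> exists I, k = pos I.
Proof.
case: (pos_cover k) => I [->|[-> xI]]; first by exists I.
by rewrite x_posS; case: (x I) xI.
Qed.

Lemma x_pred_La k : x k <> La -> exists2 j, k = j.+1 & x j = La.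
Proof.
case: (pos_cover k) => I [->|[-> xI]]; first by rewrite x_pos.
by exists (pos I) => //; rewrite x_pos.
Qed.

Lemma not_Lc_Lc k : x k = Lc -> x k.+1 = Lc -> False.
Proof.
move=> Ek Ek1; have [|j [<-]] := @x_pred_La k.+1; first by rewrite Ek1.
by rewrite Ek.
Qed.

(** The first two of them would start the blocks of two consecutive letters [Lc]. *)
Lemma not_La_La_La k : x k = La -> x k.+1 = La -> x k.+2 = La -> False.
Proof.
move=> /pos_of_La [I ->]; rewrite x_posS => H.
have E : x I = Lc by case: (x I) H.
have -> : (pos I).+1 = pos I.+1 by rewrite posS E addn1.
rewrite x_posS => H1; apply: (not_Lc_Lc E).
by case: (x I.+1) H1.
Qed.

(** * Periodic segments, their images and their desubstitution *)

Definition per p i j := forall k, i <= k -> k + p < j -> x k = x (k + p).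

Lemma per_sub p i j i' j' : i <= i' -> j' <= j -> per p i j -> per p i' j'.
Proof. by move=> lei lej P k lek ltk; apply: P; lia. Qed.

(** Sliding a window of length [q] along the segment only rotates its letters, so the length of its
    image does not change. *)
Lemma per_pos_add q I J K : per q I J -> I <= K -> K + q <= J ->
  pos (K + q) + pos I = pos K + pos (I + q).
Proof.
move=> P /subnKC <-; elim: (K - I) => [|d IH] leJ; first by rewrite addn0 addnC.
rewrite addnS addSn !posS -(P (I + d)); [|lia|lia].
by have := IH ltac:(lia); lia.
Qed.

(** The extra letter at the end comes from the next block, which starts with [La] whatever its
    letter is. *)
Lemma per_image q I J : I + q <= J -> per q I J ->
  per (pos (I + q) - pos I) (pos I) (pos J).+1.
Proof.
move=> leJ P k lek ltk.
have lepos : pos I <= pos (I + q) by rewrite leq_pos leq_addr.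
case: (pos_cover k) lek ltk => K [->|[-> xK]] leK ltK.
  have IK : I <= K by rewrite -leq_pos.
  have KJ : K + q <= J.
    rewrite leqNgt; apply/negP => H.
    have PJ := @per_pos_add q I J (J - q) P ltac:(lia) ltac:(lia).
    have : pos (J - q) < pos K by rewrite ltn_pos; lia.
    rewrite subnK in PJ; lia.
  have := per_pos_add P IK KJ.
  move=> E; have -> : pos K + (pos (I + q) - pos I) = pos (K + q) by lia.
  by rewrite !x_pos.
have EK : pos K.+1 = (pos K).+2 by rewrite posS; case: (x K) xK => //= _; lia.
have IK : I <= K by rewrite -ltnS -ltn_pos EK ltnS.
have KJ : K + q < J.
  rewrite ltnNge; apply/negP => H.
  have PJ := @per_pos_add q I J (J - q) P ltac:(lia) ltac:(lia).
  have : pos (J - q) <= pos K by rewrite leq_pos; lia.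
  rewrite subnK in PJ; lia.
have E := per_pos_add P IK (ltnW KJ).
have -> : (pos K).+1 + (pos (I + q) - pos I) = (pos (K + q)).+1 by lia.
by rewrite !x_posS -P.
Qed.

(** Each [La] is a block start, so the shift by [p] sends blocks to blocks, and by [next_inj] it
    preserves their letters. *)
Lemma per_desubst p i j : 0 < p -> i + p + 1 < j -> per p i j ->
  exists I q J, [/\ 0 < q, I + q <= J, pos I <= i, j <= (pos J).+1 & per q I J]
   /\ p = pos (I + q) - pos I.
Proof.
move=> p_gt0 ltj P.
(* If [x i] is not [La], then both [x i] and [x (i + p)] follow an [La], so the period extends one
   letter to the left. *)
have [i' [lei xi ext]] : exists i', [/\ i' <= i, x i' = La & per p i' j].
  have [Ei|nEi] := eqVneq (x i) La; first by exists i.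
  have [i' Ei' xi'] := x_pred_La (elimN eqP nEi).
  have [|j' Ej' xj'] := @x_pred_La (i + p).
    by rewrite -P //; [exact/eqP|lia].
  exists i'; split=> //; first by lia.
  move=> k; rewrite leq_eqVlt => /orP [/eqP <- _|lek]; last by apply: P; lia.
  by rewrite xi' -xj'; congr x; lia.
case: (pos_of_La xi) => I EI.
have xip : x (i' + p) = La by rewrite -ext //; lia.
case: (pos_of_La xip) => I' EI'.
have ltI : I < I' by rewrite -ltn_pos; lia.
have EI2 : p = pos I' - pos I by lia.
have exJ : exists J, j <= (pos J).+1.
  by exists j; rewrite leqW // (leq_trans _ (size_sigma _)) // size_mkseq.
(* Minimality of [J] keeps the letter after each block start of index below [J] inside the
   segment. *)
case: (ex_minnP exJ) => J leJ minJ.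
exists I, (I' - I), J.
have key d : I' + d <= J -> pos (I' + d) = pos (I + d) + p /\
    forall e, e < d -> x (I + e) = x (I' + e).
  elim: d => [|d IH] led; first by rewrite !addn0; split=> //; lia.
  have [|E H] := IH; first by lia.
  have Ex : x (I + d) = x (I' + d).
    apply: next_inj; rewrite -!x_posS E -addSn; apply: ext.
      by rewrite leqW // EI leq_pos leq_addr.
    rewrite addSn -E ltnNge; apply/negP => /minJ; lia.
  split; first by rewrite !addnS !posS E Ex; lia.
  by move=> e; rewrite ltnS leq_eqVlt => /orP [/eqP -> //|]; apply: H.
have leIJ : I' <= J by rewrite -leq_pos; lia.
split; last by rewrite subnKC ?(ltnW ltI).
split=> //; try lia.
move=> K leK ltK; have [|_ /(_ (K - I))] := key (J - I'); first by lia.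
rewrite subnKC // => ->; last by lia.
by congr x; lia.
Qed.

(** * Runs generated by the factor [La La] *)

Lemma mkseq_iter_pos m I : mkseq x (iter m pos I) = iter m sigma (mkseq x I).
Proof. by elim: m => //= m <-; rewrite mkseq_pos. Qed.

Lemma iter_posS m I : x I = La -> iter m pos I.+1 = iter m pos I + t m.
Proof.
move=> xI; have size_pos K : iter m pos K = size (iter m sigma (mkseq x K)).
  by rewrite -mkseq_iter_pos size_mkseq.
by rewrite !size_pos mkseqS -cats1 iter_sigma_cat size_cat xI.
Qed.

Lemma leq_iter_pos m I J : I <= J -> iter m pos I <= iter m pos J.
Proof. by move=> leIJ; elim: m => //= m; rewrite leq_pos. Qed.

Definition La_La I := x I = La /\ x I.+1 = La.

(** The image of a run is followed by a block start, whence the final [La] in [run]. *)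
Lemma mkseq_run m I : La_La I ->
  mkseq x (iter m pos I + size (run m)) = iter m sigma (mkseq x I) ++ run m.
Proof.
move=> [xI xI1]; elim: m => [|m IH] /=.
  by rewrite addn2 !mkseqS xI xI1 -!cats1 -catA.
have E := mkseq_pos (iter m pos I + size (run m)).
rewrite IH sigma_cat in E.
have E2 := congr1 size E; rewrite size_mkseq size_cat -mkseq_iter_pos in E2.
rewrite -[size (sigma (mkseq x _))]/(pos _) in E2.
rewrite size_rcons addnS -E2 mkseqS E x_pos.
by rewrite -rcons_cat.
Qed.

Lemma pos_run m I : La_La I ->
  (pos (iter m pos I + size (run m))).+1 = iter m.+1 pos I + size (run m.+1).
Proof.
move=> HI; rewrite /pos mkseq_run // sigma_cat size_cat /= size_rcons addnS.
by rewrite -mkseq_iter_pos.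
Qed.

Lemma per_run m I : La_La I ->
  per (t m) (iter m pos I) (iter m pos I + size (run m)).
Proof.
move=> HI; have [xI xI1] := HI.
elim: m => [|m IH].
  by rewrite /= -[t 0]/1 => k lek ltk; have -> : k = I; [lia|rewrite addn1 xI].
rewrite -pos_run //.
have E := iter_posS m xI; have E1 := iter_posS m.+1 xI.
have -> : t m.+1 = pos (iter m pos I + t m) - pos (iter m pos I).
  by rewrite -E -/(iter m.+1 pos _) -/(iter m.+1 pos I) E1 addKn.
by apply: per_image IH; rewrite leq_add2l; move: (size_run m); lia.
Qed.

Lemma run_of_per p i j : 0 < p -> i + 3 * p <= j.+1 -> per p i j ->
  exists m I, [/\ La_La I, p = t m, iter m pos I <= i &
     j <= iter m pos I + size (run m)].
Proof.
have [n] := ubnP p; elim: n => // n IH in p i j *; rewrite ltnS => lepn p_gt0 ltj P.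
(* Two equal neighbours must be [La], and [La La La] does not occur, so the segment has exactly two
   letters. *)
have [p1|p_neq1] := eqVneq p 1.
  subst p; have Ei : x i = x i.+1 by rewrite P ?addn1 //; lia.
  have HI : La_La i.
    case E: (x i); rewrite /La_La -Ei E //.
      by have [|j' [<-]] := @x_pred_La i.+1; [rewrite -Ei E|rewrite E].
    by case: (@not_Lc_Lc i); rewrite -?Ei.
  have [xi xi1] := HI; exists 0, i; split=> //=; rewrite leqNgt; apply/negP => lt.
  by case: (@not_La_La_La i) => //; rewrite -[i.+2]addn1 -(P i.+1) //; lia.
have [|I [q [J [[q_gt0 leJ leI lejJ PJ] Ep]]]] := per_desubst p_gt0 _ P; first by lia.
have ltIq : pos I <= pos (I + q) by rewrite leq_pos leq_addr.
have ltqp : q < p.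
  have [q1|q_neq1] := eqVneq q 1; first by lia.
  (* The first two letters are not both [Lc], so their image has at least three letters. *)
  have two : pos I + 3 <= pos I.+2.
    rewrite !posS; case E: (x I); case E1: (x I.+1) => //=; try lia.
    by case: (not_Lc_Lc E E1).
  have grow d : pos I.+2 + d <= pos (I.+2 + d).
    elim: d => [|d IHd]; first by rewrite !addn0.
    by rewrite !addnS (posS (I.+2 + d)); case: (x (I.+2 + d)) => /=; lia.
  have := grow (q - 2); have -> : I.+2 + (q - 2) = I + q by lia.
  lia.
(* If at least two letters are missing for length 3 q, their blocks have total length
   at most 2, so that both letters are Lc. *)
have [ltJ|geJ] := ltnP (J.+1) (I + 3 * q).
  have E1 := @per_pos_add q I J (J - q) PJ ltac:(lia) ltac:(lia).
  rewrite subnK in E1; last by lia.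
  have [ltJ2|leJ2] := ltnP J (I + 2 * q).
    have : pos (J - q) < pos (I + q) by rewrite ltn_pos; lia.
    lia.
  have E2 := @per_pos_add q I J (J - q - q) PJ ltac:(lia) ltac:(lia).
  rewrite subnK in E2; last by lia.
  have : pos (J - q - q) <= pos (I + q - 2) by rewrite leq_pos; lia.
  have two : pos (I + q - 2) + 3 <= pos (I + q).
    have -> : I + q = (I + q - 2).+2 by lia.
    rewrite subSS subSS subn0 !posS.
    case E: (x (I + q - 2)); case E3: (x (I + q - 2).+1) => //=; try lia.
    by case: (not_Lc_Lc E E3).
  lia.
have [|m [I' [HI' Eq leI' leJ']]] := IH q I J _ q_gt0 geJ PJ; first by lia.
exists m.+1, I'; split=> //.
(* The image of a window of length [q] is as long at [I] as at the start of the run, where its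
   length is [t m.+1]. *)
- have := @per_pos_add _ _ _ I (@per_run m _ HI') leI'.
  rewrite -Eq => /(_ ltac:(lia)) E.
  have := iter_posS m.+1 HI'.1; rewrite !iterS iter_posS; last exact: HI'.1.
  by rewrite -Eq; lia.
- by apply: leq_trans leI; rewrite iterS leq_pos.
- by rewrite -pos_run //; apply: leq_trans lejJ _; rewrite ltnS leq_pos.
Qed.

(** * The first occurrence of [La La] and its runs *)

Lemma x_lt13 k : k < 13 -> x k = nth La (iter 4 sigma [:: La]) k.
Proof.
move=> ltk; have E : mkseq x 1 = [:: La] by rewrite /mkseq /=; case: x_trib => ->.
have E13 : mkseq x (iter 4 pos 1) = iter 4 sigma [:: La] by rewrite mkseq_iter_pos E.
have E2 := congr1 size E13; rewrite size_mkseq in E2.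
by rewrite -E13 nth_mkseq // E2.
Qed.

Lemma La_La6 : La_La 6.
Proof. by split; rewrite x_lt13. Qed.

Lemma La_La_ge6 I : La_La I -> 6 <= I.
Proof.
by case=> H H1; do 6?[case: I H H1 => [|I] H H1];
  [move: H H1; rewrite !x_lt13..|].
Qed.

Definition first_run m := iter m pos 6.

Lemma first_runE m : first_run m = t m.+2 + t m.+1.
Proof.
rewrite -[first_run m](size_mkseq x) mkseq_iter_pos.
have -> : mkseq x 6 = iter 2 sigma [:: La] ++ iter 1 sigma [:: La].
  by rewrite /mkseq /= !x_lt13.
by rewrite iter_sigma_cat size_cat -!iterD addn2 addn1.
Qed.

Lemma x_run m I k : La_La I -> k < size (run m) ->
  x (iter m pos I + k) = nth La (run m) k.
Proof.
move=> HI ltk; have := congr1 (fun s => nth La s (iter m pos I + k)) (mkseq_run m HI).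
rewrite nth_mkseq ?ltn_add2l // => ->.
by rewrite -mkseq_iter_pos nth_cat size_mkseq ltnNge leq_addr addKn.
Qed.

(** * Occurrences of cubes *)

Definition occurs u i := mkseq (fun k => x (i + k)) (size u) = u.

Lemma occursP u i :
  occurs u i <-> forall k, k < size u -> x (i + k) = nth La u k.
Proof.
split=> [E k ltk|H]; first by rewrite -E nth_mkseq ?size_mkseq.
apply: (@eq_from_nth _ La); first by rewrite size_mkseq.
by move=> k; rewrite size_mkseq => ltk; rewrite nth_mkseq // H.
Qed.

Lemma map_x_iota i l : map x (iota i l) = mkseq (fun k => x (i + k)) l.
Proof. by rewrite /mkseq -{1}[i]addn0 iotaDl -map_comp. Qed.

Lemma infix_mkseqP u n :
  reflect (exists2 i, i + size u <= n & occurs u i) (infix u (mkseq x n)).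
Proof.
apply: (iffP idP) => [/infixP [v [v' E]]|[i lei Hu]].
  have := congr1 size E; rewrite !size_cat size_mkseq => En.
  exists (size v); first by rewrite En addnA leq_addr.
  apply/occursP => k ltk.
  have := congr1 (fun s => nth La s (size v + k)) E.
  rewrite nth_mkseq; last by rewrite En ltn_add2l ltn_addr.
  by move=> ->; rewrite nth_cat ltnNge leq_addr addKn nth_cat ltk.
apply/infixP; exists (mkseq x i), (mkseq (fun k => x (i + size u + k)) (n - (i + size u))).
have {1}-> : n = i + (size u + (n - (i + size u))) by lia.
rewrite /mkseq !iotaD !map_cat add0n !map_x_iota Hu.
by rewrite -/(mkseq x i).
Qed.

Definition cube (w : seq letter) := w ++ w ++ w.

Lemma size_cube w : size (cube w) = 3 * size w.
Proof. by rewrite !size_cat; lia. Qed.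

Lemma per_cube w i : occurs (cube w) i -> per (size w) i (i + 3 * size w).
Proof.
move/occursP; rewrite size_cube => H k /subnKC <-; move: (k - i) => d ltd.
rewrite -addnA !H; [|lia|lia].
rewrite /cube [RHS]nth_cat ltnNge leq_addl /= addnK catA nth_cat size_cat.
by have -> : d < size w + size w by lia.
Qed.

Lemma cube_per p i : per p i (i + 3 * p) ->
  occurs (cube (mkseq (fun k => x (i + k)) p)) i.
Proof.
move=> P; apply/occursP; rewrite size_cube size_mkseq /cube => k ltk.
rewrite !nth_cat size_mkseq; case: ltnP => [?|le1]; first by rewrite nth_mkseq.
have E d : d + p < 3 * p -> x (i + (d + p)) = x (i + d).
  by move=> ltd; rewrite addnA -P //; lia.
rewrite -{1}(subnK le1) E; last by lia.
case: ltnP => [?|le2]; first by rewrite nth_mkseq.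
by rewrite -{1}(subnK le2) E ?nth_mkseq //; lia.
Qed.

(** Runs of equal index carry the same letters, so the cube moves to the first run with its offset
    unchanged. *)
Lemma first_cube (w : seq letter) i : w != [::] -> occurs (cube w) i ->
  exists m e, [/\ size w = t m, e + 3 * t m <= size (run m),
    first_run m + e <= i & occurs (cube w) (first_run m + e)].
Proof.
move=> wN0 Hw; have w_gt0 : 0 < size w by case: w wN0 {Hw}.
have [m [I [HI Ew leI lei]]] := run_of_per w_gt0 (leqnSn _) (per_cube Hw).
have leF : first_run m <= iter m pos I by apply/leq_iter_pos/La_La_ge6.
exists m, (i - iter m pos I); split=> //; try lia.
apply/occursP => k; rewrite size_cube => ltk; rewrite -addnA (x_run La_La6); last by lia.
rewrite -(x_run HI); last by lia.
by rewrite addnA subnKC //; move/occursP: Hw; apply; rewrite size_cube.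
Qed.

Lemma run_cube_inj w m e e' : size w = t m -> e' + 3 * t m <= size (run m) ->
  occurs (cube w) (first_run m + e) -> occurs (cube w) (first_run m + e') -> e' <= e.
Proof.
move=> Ew le' /occursP H /occursP H'; rewrite leqNgt; apply/negP => lte.
rewrite !size_cube Ew in H H'.
have P : per (e' - e) (first_run m + e) (first_run m + e' + 3 * t m).
  move=> k /subnKC <-; move: (k - _) => d ltd.
  rewrite H; last by lia.
  by rewrite -H'; [congr x|]; lia.
have := size_run_lt m => ltm.
(* With [d = e' - e = t m'], the union of the two occurrences has length [3 * t m + d < 4 * d], so
   [t m < d]; but [d < t m] by the length of [run m]. *)
have [||m' [I [_ Ed leI leE]]] := run_of_per _ _ P; try lia.
by have := size_run_lt m'; lia.
Qed.

(** The first run that holds a cube is [run 3], of length 21 = 3 * 7; this matches the bound 7 = 3 +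
    4 in [cube_position]. *)
Lemma run_cube_ge3 m e : e + 3 * t m <= size (run m) -> 2 < m.
Proof.
by case: m => [|[|[|m]]] //; rewrite size_run ?big_ord_recr big_ord0 /t /=; lia.
Qed.

(** * End positions of cubes in the first runs *)

(** The interval of index [m + 4] goes from the end of the cube at offset 0 in the first run,
    [t m.+3 + 2 * t m], to the end of that run. *)
Lemma cube_positionP n :
  cube_position n <->
  exists m e, e + 3 * t m <= size (run m) /\ n = first_run m + e + 3 * t m.
Proof.
have E1 m : m + 4 - 1 = m.+3 by lia.
have E3 m : m + 4 - 3 = m.+1 by lia.
split=> [[m' m7 /andP []]|[m [e [le_e ->]]]].
  move: (cube_position_upper m7); rewrite -(@subnK 4 m'); last by apply: leq_trans m7.
  move: (m' - 4) => m; rewrite E1 E3 addnK => E lo hi.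
  exists m, (n - (first_run m + 3 * t m)); rewrite first_runE size_run.
  by have := t_rec m; have := sum_t m; lia.
have m7 : 7 <= m + 4 by rewrite (leq_add2r 4 3) (run_cube_ge3 le_e).
exists (m + 4) => //; move: (cube_position_upper m7) le_e.
rewrite E1 E3 addnK first_runE size_run.
by have := t_rec m; have := sum_t m; lia.
Qed.

(** For [m < m'], the run of index [m] at [first_run m] ends before [first_run m' + 3 * t m']. *)
Lemma cube_position_inj m e m' e' :
    e + 3 * t m <= size (run m) -> e' + 3 * t m' <= size (run m') ->
  first_run m + e + 3 * t m = first_run m' + e' + 3 * t m' -> m = m'.
Proof.
wlog ltm : m e m' e' / m < m'.
  move=> W H H' E; case: (ltngtP m m') => // lt; first exact: W E.
  by symmetry; apply: W (esym E).
move=> H H' E; exfalso.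
have T := leq_t ltm; have T1 : t m.+2 <= t m'.+1 by apply: leq_t.
have T2 : t m.+3 <= t m'.+2 by apply: leq_t.
move: E H; rewrite !first_runE size_run.
have := sum_t m; have := t_rec m; have := t_rec m.+1.
have := leq_tS m; have := leq_tS m.+1; lia.
Qed.

(** * Cubes completed at a given position *)

Definition new_cube (w : seq letter) n :=
  [&& w != [::], infix (cube w) (mkseq x n) & ~~ infix (cube w) (mkseq x n.-1)].

(** The copy given by [first_cube] lies no further right, and being new forces it to end at [n]
    exactly. *)
Lemma new_cubeE w n : new_cube w n ->
  exists m e, [/\ size w = t m, e + 3 * t m <= size (run m),
    n = first_run m + e + 3 * t m & occurs (cube w) (first_run m + e)].
Proof.
case/and3P=> wN0 /infix_mkseqP [i lei Hi] Hn.
have min j : occurs (cube w) j -> n.-1 < j + 3 * size w.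
  move=> Hj; rewrite ltnNge; apply: contra Hn => lej.
  by apply/infix_mkseqP; exists j; rewrite ?size_cube.
have [m [e [Ew le_e leF HF]]] := first_cube wN0 Hi.
exists m, e; split=> //; have := min _ HF; rewrite size_cube in lei.
by lia.
Qed.

Lemma new_cube_position w n : new_cube w n -> cube_position n.
Proof.
by case/new_cubeE=> m [e [_ le_e En _]]; apply/cube_positionP; exists m, e.
Qed.

Lemma new_cube_uniq w w' n : new_cube w n -> new_cube w' n -> w = w'.
Proof.
case/new_cubeE=> m [e [Ew le_e En /occursP H]].
case/new_cubeE=> m' [e' [Ew' le_e' En' /occursP H']].
have Em : m = m' by apply: (cube_position_inj le_e le_e'); rewrite -En.
subst m'; have Ee : e = e' by lia.
subst e'; apply: (@eq_from_nth _ La); first by rewrite Ew.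
move=> k ltk; have : nth La (cube w) k = nth La (cube w') k.
  by rewrite -H ?H' // size_cube ?Ew' -?Ew; lia.
by rewrite /cube !nth_cat Ew' -Ew ltk.
Qed.

Lemma new_cube_exists n : cube_position n -> exists w, new_cube w n.
Proof.
case/cube_positionP=> m [e [le_e En]].
pose w := mkseq (fun k => x (first_run m + e + k)) (t m).
have Ew : size w = t m by rewrite size_mkseq.
have t_gt0 : 0 < t m by exact: leq_ltn_trans (size_iter_sigma m).
have wN0 : w != [::] by rewrite -size_eq0 Ew -lt0n.
have Hw : occurs (cube w) (first_run m + e).
  apply: cube_per; apply: (per_sub _ _ (per_run (m := m) La_La6)).
    exact: leq_addr.
  by rewrite -addnA leq_add2l.
exists w; apply/and3P; split=> //.
  by apply/infix_mkseqP; exists (first_run m + e); rewrite // size_cube Ew En.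
(* An earlier occurrence would yield a second copy in the same first run at an offset below [e]. *)
apply/negP => /infix_mkseqP [i]; rewrite size_cube => lei Hi.
have [m' [e' [Ew' le_e' leF HF]]] := first_cube wN0 Hi.
have Em : m = m'.
  by apply: t_inj; [exact: run_cube_ge3 le_e|exact: run_cube_ge3 le_e'|rewrite -Ew].
by subst m'; have := run_cube_inj Ew le_e HF Hw; lia.
Qed.

End Word.

(** * Counting the cubes *)

(** The type [n.-bseq letter] varies with [n]; lists of plain words make the cubes for [n.-1] and
    [n] comparable. *)
Lemma C_enum x n : exists2 S : seq (seq letter), uniq S /\ C x n = size S &
  forall w, w \in S = (w != [::]) && infix (w ++ w ++ w) (mkseq x n).
Proof.
pose S := [set w : n.-bseq letter |
  (w != [::] :> seq letter) && infix (w ++ w ++ w) (mkseq x n)].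
exists (map (fun w : n.-bseq letter => w : seq letter) (enum S)).
  by rewrite size_map -cardE map_inj_uniq ?enum_uniq //; apply: val_inj.
move=> w; apply/mapP/idP => [[v]|Hw]; first by rewrite mem_enum inE => Hv ->.
have lewn : size w <= n.
  case/andP: Hw => _ /size_infix; rewrite !size_cat size_mkseq.
  exact/leq_trans/leq_addr.
by exists (Bseq lewn); rewrite // mem_enum inE.
Qed.

Theorem propositionc (x : nat -> letter) (x_trib : tribonacci_word x)
    (n : nat) (n_gt0 : 0 < n) :
  (cube_position n -> c x n = 1%R) /\ (~ cube_position n -> c x n = 0%R).
Proof.
have [S [uS ES] SP] := C_enum x n.-1.
have infixW w : infix (cube w) (mkseq x n.-1) -> infix (cube w) (mkseq x n).
  case/infix_mkseqP=> i lei Hi; apply/infix_mkseqP; exists i => //.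
  exact: leq_trans lei (leq_pred n).
split=> Hn; rewrite /c ES.
  have [w0 Hw0] := new_cube_exists x_trib Hn.
  suff -> : C x n = size (w0 :: S) by rewrite /=; lia.
  apply: C_spec; first by rewrite /= uS SP andbT; case/and3P: Hw0 => -> _ /=.
  move=> w; rewrite inE SP; have [->|neq] /= := eqVneq w w0.
    by case/and3P: Hw0 => -> ->.
  case: eqP => //= /eqP wN0; apply/idP/idP; first exact: infixW.
  move=> Hw; apply: contraNT neq => Hw'.
  by apply/eqP/(new_cube_uniq x_trib _ Hw0); apply/and3P.
suff -> : C x n = size S by lia.
apply: C_spec => // w; rewrite SP; case: eqP => //= /eqP wN0.
apply/idP/idP; first exact: infixW.
move=> Hw; apply/negPn/negP => Hw'; apply: Hn.
by apply: (new_cube_position (w := w) x_trib); apply/and3P.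
Qed.
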